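(* A finite group $G$ is the union of any three irredundant proper subgroups if and only if it is isomorphic to $C_2\times C_2$ or $Q_8$.
   Context: $C_2$ denotes the cyclic group of order $2$ and $Q_8$ the quaternion group of order $8$. Three subgroups of $G$ are called irredundant if no one of them is contained in the (set-theoretic) union of the other two.
   Formalization: ''G is the union of any three irredundant proper subgroups'' is taken to include that G has at least one such triple of subgroups; otherwise groups with none, such as the cyclic group of order 3, would satisfy it vacuously and the equivalence would fail. *)

(* Defs.v *)
From HB Require Import structures.
From mathcomp Require Import all_boot all_order all_fingroup all_algebra all_solvable.

Set Implicit Arguments.
Unset Strict Implicit.
Unset Printing Implicit Defensive.

Local Open Scope group_scope.

Definition irredundant3 (gT : finGroupType) (A B C : {group gT}) : bool :=
  [&& ~~ (A \subset B :|: C), ~~ (B \subset A :|: C) & ~~ (C \subset A :|: B)].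

Definition proper_irredundant3 (gT : finGroupType) (G A B C : {group gT}) : bool :=
  [&& A \proper G, B \proper G, C \proper G & irredundant3 A B C].

(* The first conjunct is needed: a group with no irredundant triple of proper
   subgroups, such as a cyclic group of prime power order, satisfies the second
   one vacuously. *)
Definition union_of_any_irredundant3 (gT : finGroupType) (G : {group gT}) : Prop :=
  (exists A B C : {group gT}, proper_irredundant3 G A B C) /\
  (forall A B C : {group gT}, proper_irredundant3 G A B C ->
     G :=: A :|: B :|: C).

(* Main.v *)
(** By Scorza's argument, three irredundant subgroups [A], [B], [C] covering [G]
    have index 2, and any two of them meet in the same subgroup [N] of index 4.
    If every irredundant triple of proper subgroups covers [G], then replacing a
    member of this triple by another proper subgroup shows that a proper
    subgroup is either one of [A], [B], [C] or contained in [N].  Hence [A] and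
    [B] are cyclic, [N] is central and [G] is a 2-group.  If [N] is trivial, [G]
    has order 4; otherwise all involutions lie in the cyclic group [N], so [G]
    is a generalized quaternion group, whose center has order 2, and [G] has
    order 8.
    Conversely, both groups have order [4m] for some subgroup [Z] of order [m]
    contained in all nontrivial subgroups, so three irredundant proper
    subgroups have order [2m] and meet pairwise in [Z], and a count shows that
    they cover [G]. *)
Require Import Defs.
From mathcomp Require Import all_boot all_order all_fingroup all_algebra all_solvable.

Set Implicit Arguments.
Unset Strict Implicit.
Unset Printing Implicit Defensive.

Local Open Scope group_scope.

(** * Irredundance as pairwise non-inclusion *)

(** No group is the union of two proper subgroups: if [x] in [A] avoids [B], then for [y] in both,
    [x * y] avoids [B], so [x] and [x * y] lie in [C], and hence so does [y]. *)
Lemma subGU (gT : finGroupType) (A B C : {group gT}) :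
  (A \subset B :|: C) = (A \subset B) || (A \subset C).
Proof.
apply/idP/orP => [/subsetP sABC | [] /subset_trans -> //]; last 2 first.
- exact: subsetUl.
- exact: subsetUr.
case: (boolP (A \subset B)) => [|/subsetPn[x Ax nBx]]; [by left | right].
have Cx: x \in C by have:= sABC x Ax; rewrite inE (negPf nBx).
apply/subsetP=> y Ay; have:= sABC y Ay; rewrite inE => /orP[By | //].
have:= sABC (x * y) (groupM Ax Ay); rewrite inE (groupMr _ By) (negPf nBx).
by rewrite groupMl.
Qed.

Lemma irredundant3E (gT : finGroupType) (A B C : {group gT}) :
  irredundant3 A B C =
    [&& ~~ (A \subset B), ~~ (A \subset C), ~~ (B \subset A),
        ~~ (B \subset C), ~~ (C \subset A) & ~~ (C \subset B)].
Proof. by rewrite /irredundant3 !subGU !negb_or -!andbA. Qed.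

Lemma irredundant3_rot (gT : finGroupType) (A B C : {group gT}) :
  irredundant3 A B C = irredundant3 B C A.
Proof. by rewrite !irredundant3E; do 6!case: (_ \subset _). Qed.

Lemma proper_irredundant3_rot (gT : finGroupType) (G A B C : {group gT}) :
  proper_irredundant3 G A B C = proper_irredundant3 G B C A.
Proof.
by rewrite /proper_irredundant3 (irredundant3_rot A); do 3!case: (_ \proper _).
Qed.

(** * Scorza's argument for coverings by three subgroups *)

(** Multiplying [d] in [A :&: B] by some [c] of [C] outside [A] and [B] gives an element still
    outside both, hence in [C]. *)
Lemma scorza_capS (gT : finGroupType) (G A B C : {group gT}) :
  G :=: A :|: B :|: C -> irredundant3 A B C -> A :&: B \subset C.
Proof.
move=> defG /and3P[_ _ /subsetPn[c Cc]].
rewrite inE negb_or => /andP[nAc nBc].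
apply/subsetP=> d /setIP[Ad Bd].
have Gd: d \in G by rewrite defG !inE Ad.
have Gc: c \in G by rewrite defG !inE Cc orbT.
have:= groupM Gd Gc; rewrite defG !inE groupMl // groupMl //.
by rewrite (negPf nAc) (negPf nBc) groupMr.
Qed.

(** Outside [A], the subgroups [B] and [C] are disjoint, so a product of elements taken from each
    there can only lie in [A]. Hence a single nontrivial coset of [A] fills the rest of [G]. *)
Lemma scorza_index (gT : finGroupType) (G A B C : {group gT}) :
  G :=: A :|: B :|: C -> irredundant3 A B C -> #|G : A| = 2.
Proof.
move=> defG irr; have irr' := irr; rewrite irredundant3_rot in irr'.
have defG': G :=: B :|: C :|: A by rewrite defG -setUA setUC.
have sBCA := subsetP (scorza_capS defG' irr').
have sAG: A \subset G by rewrite defG -setUA subsetUl.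
case/and3P: irr => _ /subsetPn[b Bb nACb] /subsetPn[c Cc nABc].
move: nACb nABc; rewrite !inE !negb_or => /andP[nAb nCb] /andP[nAc nBc].
have Gb: b \in G by rewrite defG !inE Bb orbT.
have Gc: c \in G by rewrite defG !inE Cc orbT.
have BnA x: x \in B -> x \notin A -> x \notin C.
  by move=> Bx; apply: contra => Cx; rewrite sBCA ?inE ?Bx.
have CnA x: x \in C -> x \notin A -> x \notin B.
  by move=> Cx; apply: contra => Bx; rewrite sBCA ?inE ?Bx.
have mulBC x y: x \in B -> x \notin A -> y \in C -> y \notin A -> x * y \in A.
  move=> Bx nAx Cy nAy.
  have Gx: x \in G by rewrite defG !inE Bx orbT.
  have Gy: y \in G by rewrite defG !inE Cy orbT.
  have:= groupM Gx Gy; rewrite defG !inE [_ \in B]groupMl //.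
  by rewrite (negPf (CnA y Cy nAy)) [_ \in C]groupMr // (negPf (BnA x Bx nAx)) !orbF.
have mulCB x y: x \in C -> x \notin A -> y \in B -> y \notin A -> x * y \in A.
  move=> Cx nAx By nAy; rewrite -groupV invMg.
  by apply: mulBC; rewrite groupV.
have sGA: G \subset A :|: A :* c.
  apply/subsetP=> x Gx; rewrite inE mem_rcoset.
  case: (boolP (x \in A)) => //= nAx.
  have:= Gx; rewrite defG !inE (negPf nAx) /= => /orP[Bx | Cx].
    by apply: mulBC; rewrite ?groupV.
  (* Both [x] and [c] lie in [C], so the detour through [b] in [B] is what makes [mulCB] applicable
     to each factor. *)
  have ->: x * c^-1 = (x * b) * (c * b)^-1 by rewrite invMg mulgA mulgK.
  by rewrite groupM ?groupV ?mulCB.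
have le2: #|G : A| <= 2.
  rewrite -(leq_pmul2l (cardG_gt0 A)) Lagrange // muln2 -addnn.
  apply: leq_trans (subset_leq_card sGA) _.
  by rewrite -{2}(card_rcoset A c) cardsU leq_subr.
apply/eqP; rewrite eqn_leq le2 ltn_neqAle eq_sym indexg_gt0 andbT.
by rewrite indexg_eq1; apply/subsetPn; exists b.
Qed.

(** * Groups covered by every irredundant triple of proper subgroups *)

Section Cover.

Variables (gT : finGroupType) (G A B C : {group gT}).
Hypotheses (irrABC : proper_irredundant3 G A B C)
  (coverG : forall X Y Z : {group gT},
     proper_irredundant3 G X Y Z -> G :=: X :|: Y :|: Z).

Lemma cover_index : #|G : A| = 2.
Proof.
by have /and4P[_ _ _] := irrABC; apply: scorza_index; apply: coverG.
Qed.

Lemma cover_capS : A :&: B \subset C.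
Proof. by apply: scorza_capS (coverG irrABC) _; case/and4P: irrABC. Qed.

Lemma cover_maximal : maximal A G.
Proof.
have /and4P[/proper_sub sAG _ _ _] := irrABC.
by apply: p_index_maximal; rewrite ?cover_index.
Qed.

End Cover.

Section CoverSubgroups.

Variables (gT : finGroupType) (G A B C : {group gT}).
Hypotheses (irrABC : proper_irredundant3 G A B C)
  (coverG : forall X Y Z : {group gT},
     proper_irredundant3 G X Y Z -> G :=: X :|: Y :|: Z).

Let irrBCA : proper_irredundant3 G B C A.
Proof. by rewrite -proper_irredundant3_rot. Qed.

Let irrCAB : proper_irredundant3 G C A B.
Proof. by rewrite proper_irredundant3_rot. Qed.

Let maxA := cover_maximal irrABC coverG.
Let maxB := cover_maximal irrBCA coverG.
Let maxC := cover_maximal irrCAB coverG.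

Let sBCA := subsetP (cover_capS irrBCA coverG).
Let sCAB := subsetP (cover_capS irrCAB coverG).

(** By maximality of [A] and [B], replacing [C] by [X] keeps the triple irredundant. The new triple
    covers [G], which forces [C] into [X]; maximality of [C] then gives equality. *)
Lemma cover_third (X : {group gT}) :
  X \proper G -> ~~ (X \subset A) -> ~~ (X \subset B) -> X :=: C.
Proof.
move=> pX nXA nXB; have /and4P[pA pB pC irr] := irrABC.
have maxS (M : {group gT}) : maximal M G -> M \subset X -> X :=: M.
  by case/maxgroupP=> _ maxM /(maxM _ pX)->.
have irrX: proper_irredundant3 G X A B.
  move: irr; rewrite irredundant3E => /and5P[nAB _ nBA _ _].
  rewrite /proper_irredundant3 pX pA pB irredundant3E nXA nXB nAB nBA /= andbT.
  by apply/andP; split; [apply: contra nXA | apply: contra nXB] => /maxS->.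
apply: maxS => //; have defX := coverG irrX.
have /and3P[_ _ /subsetPn[c Cc]] := irr; rewrite inE => /norP[nAc nBc].
have sCG := subsetP (proper_sub pC).
have sCX w: w \in C -> w \notin A -> w \notin B -> w \in X.
  move=> Cw nAw nBw; have:= sCG w Cw.
  by rewrite defX !inE (negPf nAw) (negPf nBw) !orbF.
have Xc := sCX c Cc nAc nBc; apply/subsetP=> w Cw.
case: (boolP (w \in A)) => Aw; last first.
  by rewrite sCX //; apply: contra Aw => Bw; rewrite sBCA ?inE ?Bw.
(* Since [w] is in [A] and [B], the product [w * c] lies in [C] outside both, hence in [X];
   cancelling [c] leaves [w] in [X]. *)
have Bw: w \in B by rewrite sCAB ?inE ?Cw.
by rewrite -(groupMr w Xc) sCX ?groupMl.
Qed.

End CoverSubgroups.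

Section CoverStructure.

Variables (gT : finGroupType) (G A B C : {group gT}).
Hypotheses (irrABC : proper_irredundant3 G A B C)
  (coverG : forall X Y Z : {group gT},
     proper_irredundant3 G X Y Z -> G :=: X :|: Y :|: Z).

Let irrBCA : proper_irredundant3 G B C A.
Proof. by rewrite -proper_irredundant3_rot. Qed.

Let irrCAB : proper_irredundant3 G C A B.
Proof. by rewrite proper_irredundant3_rot. Qed.

Let maxA := cover_maximal irrABC coverG.
Let sBCA := cover_capS irrBCA coverG.
Let sCAB := cover_capS irrCAB coverG.

(** If [X] lies in two of the three subgroups, it lies in their common intersection; otherwise it
    escapes two of them and must be the third. *)
Lemma cover_subgroup (X : {group gT}) :
  X \proper G ->
  [\/ X \subset A :&: B, X :=: A, X :=: B | X :=: C].
Proof.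
move=> pX; case: (boolP (X \subset A)) => XA; case: (boolP (X \subset B)) => XB.
- by constructor 1; rewrite subsetI XA.
- have [XC | nXC] := boolP (X \subset C).
    by case/negP: XB; apply: subset_trans sCAB; rewrite subsetI XC.
  by constructor 2; apply: cover_third irrBCA coverG _ pX XB nXC.
- have [XC | nXC] := boolP (X \subset C).
    by case/negP: XA; apply: subset_trans sBCA; rewrite subsetI XB.
  by constructor 3; apply: cover_third irrCAB coverG _ pX nXC XA.
by constructor 4; apply: cover_third irrABC coverG _ pX XA XB.
Qed.

(** Any element of [A] outside [B] is a generator, as no other case of [cover_subgroup] fits the
    cyclic group it generates. *)
Lemma cover_cyclic : cyclic A.
Proof.
have /and4P[pA _ _] := irrABC.
rewrite irredundant3E => /and5P[/subsetPn[a Aa nBa] _ _ _ /andP[nCA _]].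
have sa: <[a]> \subset A by rewrite cycle_subG.
apply/cyclicP; exists a.
have [||defB|defC] := cover_subgroup (sub_proper_trans sa pA) => //.
- by rewrite cycle_subG inE (negPf nBa) andbF.
- by case/negP: nBa; rewrite -defB cycle_id.
- by case/negP: nCA; rewrite -defC.
Qed.

Lemma cover_mulG : A * B = G.
Proof.
have /and4P[pA pB _] := irrABC; rewrite irredundant3E => /and3P[_ _ /andP[nBA _]].
apply: mulg_normal_maximal => //; last exact: proper_sub.
by apply: index2_normal (proper_sub pA) (cover_index irrABC coverG).
Qed.

Lemma cover_card_cap : #|G| = (4 * #|A :&: B|)%N.
Proof.
have /and4P[/proper_sub sAG /proper_sub sBG _ _] := irrABC.
have cA := Lagrange sAG; have cB := Lagrange sBG.
have := mul_cardG A B; rewrite cover_mulG.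
rewrite (cover_index irrABC coverG) in cA.
rewrite (cover_index irrBCA coverG) in cB.
move=> cAB; apply/eqP; rewrite -(eqn_pmul2l (cardG_gt0 G)) mulnCA -cAB.
by rewrite -{1}cA -{1}cB mulnACA mulnC.
Qed.

(** A proper Sylow 2-subgroup would lie in a subgroup of index 2, making its index even. *)
Lemma cover_2group : 2.-group G.
Proof.
have [P sylP] := Sylow_exists 2 G; have sPG := pHall_sub sylP.
have pP: 2.-group P := pHall_pgroup sylP.
have [<- // | pG] := eqVproper sPG.
have odd_index: odd #|G : P| by have /and3P[_ _] := sylP; rewrite -odd_2'nat.
have sub_index (M : {group gT}) :
    #|G : M| = 2 -> M \subset G -> P \subset M -> 2.-group G.
  by move=> iM sMG sPM; move: odd_index; rewrite -(Lagrange_index sMG sPM) iM oddM.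
have /and4P[/proper_sub sAG /proper_sub sBG /proper_sub sCG _] := irrABC.
have [sPN | defP | defP | defP] := cover_subgroup pG.
- apply: (sub_index A) => //; first exact: cover_index irrABC coverG.
  by apply: subset_trans sPN (subsetIl _ _).
- by apply: (sub_index A); rewrite ?defP //; apply: cover_index irrABC coverG.
- by apply: (sub_index B); rewrite ?defP //; apply: cover_index irrBCA coverG.
- by apply: (sub_index C); rewrite ?defP //; apply: cover_index irrCAB coverG.
Qed.

(** Both abelian factors of [G = A * B] centralize their intersection. *)
Lemma cover_cap_central : abelian A -> abelian B -> A :&: B \subset 'Z(G).
Proof.
have /and4P[/proper_sub sAG _ _ _] := irrABC => cAA cBB.
rewrite subsetI (subset_trans (subsetIl _ _)) //= -cover_mulG centM subsetI.
by rewrite (subset_trans (subsetIl _ _)) ?(subset_trans (subsetIr _ _)).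
Qed.

Lemma cover_not_cyclic : ~~ cyclic G.
Proof.
have /and4P[pA pB pC _] := irrABC; apply/cyclicP=> -[g defG].
have notin (M : {group gT}) : M \proper G -> g \notin M.
  by case/andP=> _; rewrite defG cycle_subG.
have: g \in G by rewrite defG cycle_id.
by rewrite (coverG irrABC) !inE !(negPf (notin _ _)).
Qed.

End CoverStructure.

(** * Identification of the two groups *)

Lemma isog_V4 (gT : finGroupType) (G : {group gT}) :
  (G \isog [set: 'Z_2 * 'Z_2]) = ~~ cyclic G && (#|G| == 4).
Proof.
have cardV: #|[set: 'Z_2 * 'Z_2]| = 4 by rewrite cardsT card_prod !card_ord.
have abelV: 2.-abelem [set: 'Z_2 * 'Z_2].
  apply/abelemP=> //; split=> [|x _]; last first.
    by case: x => [[[|[|?]] ?] [[|[|?]] ?]] //; apply/eqP.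
  by apply: (@p2group_abelian _ 2); rewrite /pgroup cardV.
rewrite isog_sym (isog_abelem_card G abelV) cardV.
apply: andb_id2r => /eqP cardG.
have pG: 2.-group G by rewrite /pgroup cardG.
apply/idP/idP => [abelG | nCG]; first by rewrite (abelem_cyclic abelG) cardG.
rewrite abelemE // (p2group_abelian pG) ?cardG //=; apply/exponentP=> x Gx.
apply/eqP; rewrite -order_dvdn.
have: #[x] %| 4 by rewrite -cardG order_dvdG.
have: #[x] != 4.
  apply: contra nCG => /eqP ox; apply/cyclicP; exists x; apply/esym/eqP.
  by rewrite eqEcard cycle_subG Gx cardG -ox /=.
by case: #[x] => [|[|[|[|[|n]]]]] // _ /dvdn_leq; apply.
Qed.

Lemma cover_isog (gT : finGroupType) (G A B C : {group gT}) :
  proper_irredundant3 G A B C ->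
  (forall X Y Z : {group gT},
     proper_irredundant3 G X Y Z -> G :=: X :|: Y :|: Z) ->
  G \isog [set: 'Z_2 * 'Z_2] \/ G \isog 'Q_8.
Proof.
move=> irrABC coverG.
have irrBCA := irrABC; rewrite proper_irredundant3_rot in irrBCA.
have irrCAB := irrBCA; rewrite proper_irredundant3_rot in irrCAB.
have cycA := cover_cyclic irrABC coverG; have cycB := cover_cyclic irrBCA coverG.
have pG := cover_2group irrABC coverG; have cardG := cover_card_cap irrABC coverG.
have nCG := cover_not_cyclic irrABC coverG.
have sNZ := cover_cap_central irrABC coverG (cyclic_abelian cycA) (cyclic_abelian cycB).
have /and4P[pA pB pC _] := irrABC.
have cardM (M : {group gT}) : M \subset G -> #|G : M| = 2 -> #|M| = (2 * #|A :&: B|)%N.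
  move=> sMG iM; apply/eqP; rewrite -(@eqn_pmul2r 2) // -{1}iM Lagrange // cardG.
  by rewrite mulnAC.
have cardA := cardM A (proper_sub pA) (cover_index irrABC coverG).
have cardB := cardM B (proper_sub pB) (cover_index irrBCA coverG).
have cardC := cardM C (proper_sub pC) (cover_index irrCAB coverG).
have [N1 | ntN] := eqVneq (A :&: B) 1.
  by left; rewrite isog_V4 nCG cardG N1 cards1.
right.
have N_gt1: 1 < #|A :&: B| by rewrite cardG_gt1.
have sNG: A :&: B \subset G := subset_trans (subsetIl _ _) (proper_sub pA).
have pN: 2.-group (A :&: B) := pgroupS sNG pG.
have cardO: #|'Ohm_1(A :&: B)| = 2.
  by apply: Ohm1_cyclic_pgroup_prime; rewrite ?(cyclicS (subsetIl A B)).
(* A subgroup generated by an [x] with [x ^+ 2 = 1] has order at most 2, whereas [A], [B] and [C]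
   have order at least 4; so [cover_subgroup] puts it in [A :&: B]. *)
have eqO: 'Ohm_1(G) = 'Ohm_1(A :&: B).
  apply/eqP; rewrite eqEsubset (OhmS 1 sNG) andbT.
  rewrite (OhmE 1 pG) (OhmE 1 pN) genS //.
  apply/subsetP=> x /setIP[Gx x2]; rewrite inE x2 andbT.
  have le2: #[x] <= 2.
    by rewrite dvdn_leq // order_dvdn; rewrite !inE in x2.
  have px: <[x]> \proper G.
    rewrite properEcard cycle_subG Gx /= cardG -orderE.
    by apply: leq_ltn_trans le2 (@leq_trans (4 * 2) _ _ _ _); rewrite ?leq_mul2l.
  have neq (M : {group gT}) : #|M| = (2 * #|A :&: B|)%N -> <[x]> <> M :> {set gT}.
    move=> oM defM; move: le2; rewrite orderE defM oM.
    by rewrite -[X in _ <= X]muln1 leq_pmul2l // leqNgt N_gt1.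
  have [|defX|defX|defX] := cover_subgroup irrABC coverG px.
  - by rewrite cycle_subG.
  - by case: (neq A cardA).
  - by case: (neq B cardB).
  - by case: (neq C cardC).
have ntG: G :!=: 1 by apply: contraNneq nCG => ->; apply: cyclic1.
have: cyclic G || (2 == 2) && (extremal_class G == Quaternion).
  by apply/(prime_Ohm1P pG ntG); rewrite eqO.
rewrite (negPf nCG) /= => /eqP/quaternion_classP[n n_gt2 isoQ].
have [[x y] genG _] := generators_quaternion n_gt2 isoQ.
have [_ _ [_ cardZ _ _ _] _ _] := quaternion_structure n_gt2 genG isoQ.
(* The intersection is nontrivial and contained in a center of order 2. *)
have N2: #|A :&: B| = 2.
  by apply/eqP; rewrite eqn_leq N_gt1 andbT -cardZ subset_leq_card.
have: #|G| = (2 ^ n)%N by rewrite (card_isog isoQ) card_quaternion.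
rewrite cardG N2 => /eqP; rewrite -[(4 * 2)%N]/(2 ^ 3)%N (eqn_exp2l 3 n) // => /eqP n3.
by rewrite -n3 in isoQ.
Qed.

(** * The converse, for both groups at once *)

(** Serves with [Z] trivial for the Klein group and [Z] generated by the involution for ['Q_8]. A
    proper subgroup not inside [Z] contains it with index 2, because two indices greater than 1
    multiply to 4. *)
Lemma quarter_union (gT : finGroupType) (G Z : {group gT}) :
  ~~ cyclic G -> #|G| = (4 * #|Z|)%N ->
  (forall X : {group gT}, X \subset G -> X :!=: 1 -> Z \subset X) ->
  union_of_any_irredundant3 G.
Proof.
move=> nCG cardG minZ; have m_gt0 := cardG_gt0 Z.
have ntG: G :!=: 1 by apply: contraNneq nCG => ->; apply: cyclic1.
have sZG: Z \subset G by apply: minZ.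
have half (X : {group gT}) : X \proper G -> ~~ (X \subset Z) ->
    Z \subset X /\ #|X : Z| = 2.
  move=> pX nXZ; have sXG := proper_sub pX.
  have sZX: Z \subset X.
    by apply: minZ => //; apply: contraNneq nXZ => ->; apply: sub1G.
  split=> //; have indZ: (#|G : X| * #|X : Z|)%N = 4.
    apply/eqP; rewrite Lagrange_index // -(eqn_pmul2l m_gt0) Lagrange // cardG.
    by rewrite mulnC.
  have GX_gt1: 1 < #|G : X| by rewrite indexg_gt1; case/andP: pX.
  apply/eqP; rewrite eqn_leq indexg_gt1 nXZ andbT.
  by rewrite -(@leq_pmul2l 2) // -[(2 * 2)%N]indZ leq_mul2r GX_gt1 orbT.
have cardX (X : {group gT}) : X \proper G -> ~~ (X \subset Z) ->
    #|X| = (2 * #|Z|)%N.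
  by move=> pX nXZ; have [sZX iX] := half X pX nXZ; rewrite -(Lagrange sZX) iX mulnC.
have capZ (X Y : {group gT}) : X \proper G -> ~~ (X \subset Z) -> Z \subset Y ->
    ~~ (X \subset Y) -> X :&: Y = Z.
  move=> pX nXZ sZY nXY; have [sZX iX] := half X pX nXZ.
  have: maximal Z X by apply: p_index_maximal; rewrite ?iX.
  case/maxgroupP=> _ /(_ (X :&: Y)%G); apply; last by rewrite subsetI sZX.
  by rewrite properE subsetIl subsetI subxx.
split; last first.
  move=> X Y W /and4P[pX pY pW]; rewrite irredundant3E.
  case/and5P=> nXY nXW nYX nYW /andP[nWX nWY].
  have notZ (U V : {group gT}) :
      V \proper G -> ~~ (U \subset V) -> ~~ (V \subset U) -> ~~ (U \subset Z).
    move=> pV nUV nVU; apply: contra nUV => /subset_trans; apply.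
    apply: minZ (proper_sub pV) _.
    by apply: contraNneq nVU => ->; apply: sub1G.
  have nX := notZ X Y pY nXY nYX; have nY := notZ Y X pX nYX nXY.
  have nW := notZ W X pX nWX nXW.
  have [sZX _] := half X pX nX; have [sZY _] := half Y pY nY.
  (* All pairwise intersections are [Z], so with [m = #|Z|] the union has
     [(2m + 2m - m) + 2m - m = 4m] elements. *)
  apply/esym/eqP; rewrite eqEcard !subUset !proper_sub //= cardG !cardsU.
  rewrite setIUl [X :&: W]setIC [Y :&: W]setIC !capZ // setUid.
  rewrite (cardX X pX nX) (cardX Y pY nY) (cardX W pW nW).
  by rewrite !mulSn mul0n addn0 !addnA !(addnK, addnA).
have nGZ: ~~ (G \subset Z).
  by apply/negP=> /subset_leq_card; rewrite cardG leqNgt ltn_Pmull.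
have pr x : x \in G -> <[x]> \proper G.
  move=> Gx; rewrite properE cycle_subG Gx; apply: contra nCG => sG.
  by apply/cyclicP; exists x; apply/eqP; rewrite eqEsubset sG cycle_subG.
(* Cyclic subgroups generated outside [Z] all have order [2 * #|Z|], so an inclusion between two of
   them is an equality. *)
have swap x y : x \in G -> y \in G -> x \notin Z -> y \notin Z ->
    x \in <[y]> -> y \in <[x]>.
  have cardc z : z \in G -> z \notin Z -> #|<[z]>| = (2 * #|Z|)%N.
    by move=> Gz nZz; apply: cardX; rewrite ?pr ?cycle_subG.
  move=> Gx Gy nZx nZy; rewrite -cycle_subG => sxy.
  suff /eqP->: <[x]> == <[y]> by apply: cycle_id.
  by rewrite eqEcard sxy (cardc x Gx nZx) (cardc y Gy nZy) /=.
have /subsetPn[a Ga nZa] := nGZ.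
have sZ x : x \in G -> x \notin Z -> Z \subset <[x]>.
  move=> Gx nZx; apply: minZ; first by rewrite cycle_subG.
  by apply: contraNneq nZx => /eqP; rewrite cycle_eq1 => /eqP->.
have nsub x : x \in G -> ~~ (G \subset <[x]>) by move/pr/andP=> [].
have /subsetPn[b Gb nab] := nsub a Ga.
have nZb: b \notin Z by apply: contra nab; apply: (subsetP (sZ a Ga nZa)).
(* The third generator exists because two proper subgroups cannot cover [G]. *)
have: ~~ (G \subset <[a]> :|: <[b]>) by rewrite subGU negb_or !nsub.
case/subsetPn=> c Gc; rewrite inE => /norP[nac nbc].
have nZc: c \notin Z by apply: contra nac; apply: (subsetP (sZ a Ga nZa)).
exists <[a]>%G, <[b]>%G, <[c]>%G.
rewrite /proper_irredundant3 !pr // irredundant3E !cycle_subG nab nac nbc !andbT /=.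
apply/and3P; split; [apply: contra nab | apply: contra nac | apply: contra nbc];
  exact: swap.
Qed.

Theorem theoremB (gT : finGroupType) (G : {group gT}) :
  union_of_any_irredundant3 G <->
  (G \isog [set: 'Z_2 * 'Z_2] \/ G \isog 'Q_8).
Proof.
split=> [[[A [B [C irrABC]]] coverG] | [isoV | isoQ]].
- exact: cover_isog irrABC coverG.
- have := isoV; rewrite isog_V4 => /andP[nCG /eqP cardG].
  apply: (quarter_union (Z := 1%G)) => // [|X _ _]; last exact: sub1G.
  by rewrite cardG cards1.
have cardG: #|G| = 8 by rewrite (card_isog isoQ) (@card_quaternion 3).
have pG: 2.-group G by rewrite /pgroup cardG.
have ntG: G :!=: 1 by rewrite -cardG_gt1 cardG.
have clG: extremal_class G = Quaternion.
  by apply/quaternion_classP; exists 3.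
have cardO: #|'Ohm_1(G)| = 2.
  by apply/(prime_Ohm1P pG ntG); rewrite clG orbT.
apply: (quarter_union (Z := 'Ohm_1(G)%G)) => [||X sXG ntX].
- have [[x y] genG _] := @generators_quaternion _ G 3 isT isoQ.
  have [_ _ [_ cardZ _ _ _] _ _] := quaternion_structure (isT : 2 < 3) genG isoQ.
  apply/negP=> /cyclic_abelian/center_idP ZG.
  by move: cardZ; rewrite ZG cardG.
- by rewrite cardG cardO.
(* As [X] is nontrivial, so is ['Ohm_1(X)], which therefore exhausts the order-2 group
   ['Ohm_1(G)]. *)
have sO: 'Ohm_1(X) \subset 'Ohm_1(G) := OhmS 1 sXG.
suff /eqP eqO: 'Ohm_1(X) == 'Ohm_1(G) by rewrite /= -eqO Ohm_sub.
by rewrite eqEcard sO cardO /= cardG_gt1 Ohm1_eq1.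
Qed.
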